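(* Let $A$, $x$, $\mathfrak{m}$, $K$, $\sigma$, $\delta$, the reduction map $p\mapsto\bar p$ from $A[t,\sigma,\delta]$ to $K[t]$, and the map $\phi$ be as described in the context. Let $f \in A[t,\sigma,\delta]$ be a monic polynomial in $t$ of degree $d$. Let $g,h \in A[t,\sigma,\delta]$ be monic polynomials of respective degrees $m$ and $d-m$ with $\bar{f} = \bar{g}\bar{h}$, such that $\bar{g}$ and $\overline{h^{\phi^{n}}}$ are relatively prime in $K[t]$ for all $n \in \mathbb{N}=\{1,2,3,\ldots\}$. Then there exist monic polynomials $\hat{g},\hat{h} \in A[t,\sigma,\delta]$ of respective degrees $m$ and $d-m$ with $\overline{\hat{g}} = \bar{g}$ and $\overline{\hat{h}} = \bar{h}$, such that $f = \hat{g}\hat{h}$.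
   Context: Rings are associative and unital. $A$ is a (possibly noncommutative) domain which is complete and separated with respect to a principal two-sided ideal $\mathfrak{m} = xA = Ax$, for some nonzero $x \in A$, and $K = A/\mathfrak{m}$ is a (commutative) field. $\sigma$ is an endomorphism of $A$ and $\delta$ is a $\sigma$-derivation of $A$, i.e. an additive map $A\to A$ with $\delta(ab) = \sigma(a)\delta(b)+\delta(a)b$ for all $a,b\in A$. It is assumed that $\sigma(\mathfrak{m}) \subseteq \mathfrak{m}$ and $\delta(\mathfrak{m}) \subseteq \mathfrak{m}$, and that the maps $\bar\sigma$ and $\bar\delta$ induced by $\sigma$ and $\delta$ on $K$ are respectively the identity and $0$. $R = A[t,\sigma,\delta]$ is the skew polynomial ring: polynomials $\sum a_i t^i$ with coefficients $a_i\in A$ written on the left, with multiplication determined by $ta = \sigma(a) t + \delta(a)$ for all $a \in A$. Since $A$ is a domain, so is $R$. Degrees are degrees in $t$. The reduction map $\sum a_i t^i \mapsto \overline{\sum a_i t^i} = \sum \bar{a}_i t^i$, where $\bar a$ is the class of $a$ in $K$, is a ring epimorphism from $R$ onto the commutative polynomial ring $K[t]$. Under these assumptions $xR = Rx$ is a two-sided ideal of $R$; hence for every $p \in R$ there is an element $p^\phi \in R$ with $p^\phi x = xp$, which is uniquely determined by $p$ since $R$ is a domain, and the map $\phi\colon p \mapsto p^\phi$ is an automorphism of $R$. Here $\phi^n$ denotes the $n$-fold iterate of $\phi$ and $h^{\phi^n} = \phi^n(h)$.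
   Formalization: The existence of φ (for every p some p^φ with p^φ x = xp) is assumed, since it does not follow from the stated assumptions: for A = k[[x]], σ(x) = x², δ = 0, the element xt is not in Rx, so φ is undefined. *)

(* Defs.v *)
From HB Require Import structures.
From mathcomp Require Import all_boot all_order all_algebra.

Set Implicit Arguments.
Unset Strict Implicit.
Unset Printing Implicit Defensive.

Import GRing.Theory.
Local Open Scope ring_scope.

Definition right_multiples (A : nzRingType) (x : A) : A -> Prop :=
  fun a => exists b, a = x * b.

Definition left_multiples (A : nzRingType) (x : A) : A -> Prop :=
  fun a => exists b, a = b * x.

(* [ideal_pow I n] is the n-th power of the two-sided ideal I, with I^0 = A:
   I^(n+1) consists of the finite sums of products a * b with a in I and b in
   I^n. *)
Fixpoint ideal_pow (A : nzRingType) (I : A -> Prop) (n : nat) : A -> Prop :=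
  if n is n'.+1 then
    fun a => exists2 s : seq (A * A),
      (forall p, p \in s -> I p.1 /\ ideal_pow I n' p.2)
      & a = \sum_(p <- s) p.1 * p.2
  else fun _ => True.

(* Injectivity of the canonical map from A to the inverse limit of the A/I^n. *)
Definition adically_separated (A : nzRingType) (I : A -> Prop) : Prop :=
  forall a, (forall n, ideal_pow I n a) -> a = 0.

(* Surjectivity of the same map: [u n] represents the n-th component of a
   compatible family of classes. *)
Definition adically_complete (A : nzRingType) (I : A -> Prop) : Prop :=
  forall u : nat -> A, (forall n, ideal_pow I n (u n.+1 - u n)) ->
  exists l, forall n, ideal_pow I n (l - u n).

Record sderivation (A : nzRingType) (sigma : {rmorphism A -> A}) :=
  SDerivation {
    sder :> {additive A -> A};
    sderM : forall a b, sder (a * b) = sigma a * sder b + sder a * b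
  }.

(* The coefficient of t^i, written on the left, is the i-th coefficient of the
   underlying polynomial.  The ring structure below depends on sigma and delta,
   so they are parameters of the type. *)
Record skew_poly (A : nzRingType) (sigma : {rmorphism A -> A})
    (delta : sderivation sigma) :=
  SkewPoly { skew_val : {poly A} }.
Arguments SkewPoly {A sigma delta} _.

Section SkewPoly.

Variables (A : nzRingType) (sigma : {rmorphism A -> A}).
Variable delta : sderivation sigma.

Local Notation skewR := (skew_poly delta).

HB.instance Definition _ := [isNew for @skew_val A sigma delta].
HB.instance Definition _ := [Choice of skewR by <:].

Implicit Types p q r : skewR.

Definition skew_add p q : skewR := SkewPoly (skew_val p + skew_val q).
Definition skew_opp p : skewR := SkewPoly (- skew_val p).

Fact skew_addA : associative skew_add.
Proof. by move=> p q r; apply: val_inj; rewrite /= addrA. Qed.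
Fact skew_addC : commutative skew_add.
Proof. by move=> p q; apply: val_inj; rewrite /= addrC. Qed.
Fact skew_add0 : left_id (SkewPoly 0) skew_add.
Proof. by move=> p; apply: val_inj; rewrite /= add0r. Qed.
Fact skew_addN : left_inverse (SkewPoly 0) skew_opp skew_add.
Proof. by move=> p; apply: val_inj; rewrite /= addNr. Qed.

HB.instance Definition _ :=
  GRing.isZmodule.Build skewR skew_addA skew_addC skew_add0 skew_addN.

Fact skew_val_is_zmod_morphism : zmod_morphism (@skew_val A sigma delta).
Proof. by []. Qed.

HB.instance Definition _ := GRing.isZmodMorphism.Build skewR {poly A}
  (@skew_val A sigma delta) skew_val_is_zmod_morphism.

(* Left multiplication by t:
   t * (\sum_i b_i t^i) = \sum_i (sigma b_i t^(i+1) + delta b_i t^i). *)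
Definition skew_mulX (v : {poly A}) : {poly A} :=
  map_poly sigma v * 'X + map_poly delta v.

(* Left multiplication by u = \sum_i u_i t^i. *)
Definition skew_act (u v : {poly A}) : {poly A} :=
  \sum_(i < size u) u`_i *: iter i skew_mulX v.

Definition skew_mul p q : skewR := SkewPoly (skew_act (skew_val p) (skew_val q)).

Fact skew_mulX_is_additive : zmod_morphism skew_mulX.
Proof.
move=> u v; rewrite /skew_mulX !raddfB /= mulrBl opprD.
by rewrite -!addrA; congr (_ + _); rewrite addrCA.
Qed.

HB.instance Definition _ :=
  GRing.isZmodMorphism.Build {poly A} {poly A} skew_mulX skew_mulX_is_additive.

Fact skew_mulXZ a v :
  skew_mulX (a *: v) = sigma a *: skew_mulX v + delta a *: v.
Proof.
apply/polyP=> i; rewrite /skew_mulX !(coefD, coefZ, coefMX, coef_map) /=.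
rewrite sderM rmorphM mulrDr addrA; congr (_ + _ + _).
by case: i => [|i] /=; rewrite ?mulr0.
Qed.

Fact skew_act_widen n (u v : {poly A}) : (size u <= n)%N ->
  skew_act u v = \sum_(i < n) u`_i *: iter i skew_mulX v.
Proof.
move=> le_un; rewrite /skew_act.
rewrite (big_ord_widen n (fun i => u`_i *: iter i skew_mulX v) le_un).
rewrite big_mkcond; apply: eq_bigr => i _ /=.
by case: ltnP => // le_ui; rewrite nth_default // scale0r.
Qed.

Fact skew_actDl u v w : skew_act (u + v) w = skew_act u w + skew_act v w.
Proof.
pose n := maxn (size u) (size v).
rewrite !(@skew_act_widen n) ?size_polyD ?leq_maxl ?leq_maxr //.
by rewrite -big_split; apply: eq_bigr => i _ /=; rewrite coefD scalerDl.
Qed.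

Fact skew_actZl a u v : skew_act (a *: u) v = a *: skew_act u v.
Proof.
rewrite (@skew_act_widen (size u)) ?size_scale_leq // scaler_sumr.
by apply: eq_bigr => i _; rewrite coefZ scalerA.
Qed.

Fact iter_skew_mulXD i u v :
  iter i skew_mulX (u + v) = iter i skew_mulX u + iter i skew_mulX v.
Proof. by elim: i => //= i ->; rewrite raddfD. Qed.

Fact skew_actDr u v w : skew_act u (v + w) = skew_act u v + skew_act u w.
Proof.
rewrite -big_split; apply: eq_bigr => i _ /=.
by rewrite iter_skew_mulXD scalerDr.
Qed.

Fact skew_act0l v : skew_act 0 v = 0.
Proof. by rewrite /skew_act size_poly0 big_ord0. Qed.

Fact skew_act_mulX u v : skew_act (skew_mulX u) v = skew_mulX (skew_act u v).
Proof.
rewrite {1}/skew_mulX skew_actDl.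
rewrite (@skew_act_widen (size u).+1) ?(@skew_act_widen (size u) (map_poly _ _)).
- rewrite big_ord_recl coefMX /= scale0r add0r raddf_sum -big_split.
  by apply: eq_bigr => i _ /=; rewrite coefMX !coef_map /= skew_mulXZ.
- exact: size_poly.
- rewrite (leq_trans (size_polyMleq _ _)) // size_polyX addn2 ltnS.
  exact: size_poly.
Qed.

Fact skew_act_suml n (F : 'I_n -> {poly A}) v :
  skew_act (\sum_(i < n) F i) v = \sum_(i < n) skew_act (F i) v.
Proof.
apply: (big_morph (skew_act^~ v)) => [u w|]; last exact: skew_act0l.
exact: skew_actDl.
Qed.

Fact skew_mulA : associative skew_mul.
Proof.
move=> [u] [v] [w]; congr SkewPoly => /=.
rewrite [in RHS]/(skew_act u v) skew_act_suml; apply: eq_bigr => i _.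
rewrite skew_actZl; congr (_ *: _).
by elim: (val i) => //= k ->; rewrite skew_act_mulX.
Qed.

Fact skew_mul1 : left_id (SkewPoly 1) skew_mul.
Proof.
move=> [v]; congr SkewPoly.
by rewrite /= /skew_act size_poly1 big_ord1 /= coef1 scale1r.
Qed.

Fact iter_skew_mulX1 i : iter i skew_mulX 1 = 'X^i.
Proof.
elim: i => [|i /= ->]; first by rewrite expr0.
rewrite /skew_mulX map_polyXn -exprSr; apply/polyP=> j.
rewrite coefD coef_map /= coefXn.
have d1 : delta 1 = 0.
  have /eqP := sderM delta 1 1; rewrite rmorph1 !mul1r mulr1.
  by rewrite -subr_eq0 opprD addNKr oppr_eq0 => /eqP.
by rewrite coefXn raddfMn /= d1 mul0rn addr0.
Qed.

Fact skew_mulr1 : right_id (SkewPoly 1) skew_mul.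
Proof.
move=> [u]; congr SkewPoly; rewrite /= -[RHS]coefK poly_def.
by apply: eq_bigr => i _; rewrite iter_skew_mulX1.
Qed.

Fact skew_mulDl : left_distributive skew_mul skew_add.
Proof. by move=> [u] [v] [w]; congr SkewPoly; apply: skew_actDl. Qed.

Fact skew_mulDr : right_distributive skew_mul skew_add.
Proof. by move=> [u] [v] [w]; congr SkewPoly; apply: skew_actDr. Qed.

Fact skew_1neq0 : SkewPoly 1 != 0 :> skewR.
Proof. by apply/eqP=> -[/eqP]; rewrite oner_eq0. Qed.

HB.instance Definition _ := GRing.Zmodule_isNzRing.Build skewR
  skew_mulA skew_mul1 skew_mulr1 skew_mulDl skew_mulDr skew_1neq0.

Definition skewC (a : A) : skewR := SkewPoly a%:P.
Definition skewX : skewR := SkewPoly 'X.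

Lemma skewC_is_zmod_morphism : zmod_morphism skewC.
Proof. by move=> a b; congr SkewPoly; rewrite raddfB. Qed.

Lemma skewC_is_monoid_morphism : monoid_morphism skewC.
Proof.
split=> // a b; congr SkewPoly; rewrite /= (@skew_act_widen 1) ?size_polyC_leq1 //.
by rewrite big_ord1 coefC /= -mul_polyC -polyCM.
Qed.

HB.instance Definition _ :=
  GRing.isZmodMorphism.Build A skewR skewC skewC_is_zmod_morphism.
HB.instance Definition _ :=
  GRing.isMonoidMorphism.Build A skewR skewC skewC_is_monoid_morphism.

Lemma skew_val_CM a p : skew_val (skewC a * p) = a *: skew_val p.
Proof.
by rewrite /= (@skew_act_widen 1) ?size_polyC_leq1 // big_ord1 coefC.
Qed.

Lemma skew_val_XM p : skew_val (skewX * p) = skew_mulX (skew_val p).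
Proof.
rewrite /= (@skew_act_widen 2) ?size_polyX //.
by rewrite big_ord_recl big_ord1 !coefX /= scale0r add0r scale1r.
Qed.

Lemma skew_commutation a :
  skewX * skewC a = skewC (sigma a) * skewX + skewC (delta a).
Proof.
apply: val_inj; change (skew_val (skewX * skewC a) =
  skew_val (skewC (sigma a) * skewX) + skew_val (skewC (delta a))).
by rewrite skew_val_XM skew_val_CM /skew_mulX !map_polyC mul_polyC.
Qed.

Lemma skew_polyE p :
  p = \sum_(i < size (skew_val p)) skewC (skew_val p)`_i * skewX ^+ i.
Proof.
have val_exp k : skew_val (skewX ^+ k) = 'X^k.
  elim: k => [|k IHk]; first by rewrite !expr0.
  by rewrite exprS skew_val_XM IHk -!iter_skew_mulX1.
apply: val_inj; change (skew_val p = skew_val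
  (\sum_(i < size (skew_val p)) skewC (skew_val p)`_i * skewX ^+ i)).
rewrite raddf_sum -[LHS]coefK poly_def.
by apply: eq_bigr => i _; rewrite [RHS]skew_val_CM val_exp.
Qed.

Definition skew_monic p : Prop := skew_val p \is monic.

Definition skew_has_degree p (d : nat) : Prop := size (skew_val p) = d.+1.

Definition skew_red (K : fieldType) (pi : {rmorphism A -> K}) p : {poly K} :=
  map_poly pi (skew_val p).

End SkewPoly.

(* Main.v *)
Require Import Defs.
From HB Require Import structures.
From mathcomp Require Import all_boot all_order all_algebra ring.

Set Implicit Arguments.
Unset Strict Implicit.
Unset Printing Implicit Defensive.

Import GRing.Theory.
Local Open Scope ring_scope.

(* Hensel lifting: monic g_n, h_n with f = g_n h_n + r x^n are corrected to
   g_n + a x^n and h_n + b x^n.  Moving the powers of x to the right turns h_n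
   into phi^n h_n, so modulo x the correction has to solve
   r = a phi^n(h_n) + g_n b in K[t], with deg a < deg g and deg b < deg h.  This is
   possible because g and phi^n h are coprime modulo x and phi preserves both
   the degree and congruence modulo x.  The coefficients of g_n and h_n converge
   x-adically. *)

(** * Sequential choice, and the Bezout equation with degree bounds *)

(** Since [P] and [Q] are boolean and [T] is a [choiceType], [xchoose] selects each successor
    without an axiom. The recursion runs on states bundled with their proof of [P n]. *)
Lemma dependent_choice (T : choiceType) (P : nat -> pred T) (Q : nat -> rel T)
    (s0 : T) :
    P 0 s0 ->
    (forall n s, P n s -> exists s', P n.+1 s' && Q n s s') ->
  exists u : nat -> T,
    u 0 = s0 /\ forall n, P n (u n) /\ Q n (u n) (u n.+1).
Proof.
move=> P0 PS.
pose next n (s : {s | P n s}) : {s' | P n.+1 s'} :=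
  exist _ (xchoose (PS n _ (svalP s)))
    (proj1 (andP (xchooseP (PS n _ (svalP s))))).
pose v : forall n, {s | P n s} := nat_rect _ (exist _ s0 P0) next.
exists (fun n => sval (v n)); split=> // n; split; first exact: svalP (v n).
by case/andP: (xchooseP (PS n _ (svalP (v n)))).
Qed.

(** Multiplying a Bezout relation by [c] gives some solution. Reducing the coefficient of [q] modulo
    [p] bounds [a]; the bound on [b] then follows from [p * b = c - a * q], as [p] is monic. *)
Lemma coprimep_solve (K : fieldType) (p q c : {poly K}) (k : nat) :
    p \is monic -> coprimep p q -> (size c <= (size p).-1 + k)%N ->
    (size q <= k.+1)%N ->
  exists a b, [/\ c = a * q + p * b, (size a < size p)%N & (size b <= k)%N].
Proof.
move=> p_monic /Bezout_eq1_coprimepP[[u v] /= uv1] c_size q_size.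
have p_neq0 := monic_neq0 p_monic.
have p_size : (0 < size p)%N by rewrite size_poly_gt0.
pose a := (c * v) %% p; pose b := c * u + (c * v) %/ p * q.
have a_size : (size a < size p)%N by rewrite ltn_modp.
have eq_c : c = a * q + p * b.
  rewrite -[LHS]mulr1 -uv1 mulrDr [c * (v * q)]mulrA (divp_eq (c * v) p) -/a /b.
  ring.
exists a, b; split=> //.
have [->|b_neq0] := eqVneq b 0; first by rewrite size_poly0.
have : (size (p * b)%R <= (size p).-1 + k)%N.
  have -> : p * b = c - a * q by rewrite eq_c addrC addKr.
  rewrite (leq_trans (size_polyD _ _)) // geq_max c_size size_polyN.
  rewrite (leq_trans (size_polyMleq _ _)) //.
  move: a_size q_size; case: (size p) p_size => // s _ /=; rewrite ltnS => sa sq.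
  by rewrite -subn1 leq_subLR add1n -addnS leq_add.
rewrite size_monicM // -{1}(prednK p_size) addSn /=.
by rewrite leq_add2l.
Qed.

(** * Degrees and leading coefficients in the skew polynomial ring *)

Section SkewDegree.

Variables (A : nzRingType) (sigma : {rmorphism A -> A}).
Variable delta : sderivation sigma.
Local Notation skewR := (skew_poly delta).
Implicit Types (u v : {poly A}) (p q : skewR).

(** The [delta] part of [t v] has degree at most that of [v], so it cannot reach the top term, which
    comes from [sigma]. *)
Lemma skew_mulX_lead v : sigma (lead_coef v) != 0 ->
  size (skew_mulX delta v) = (size v).+1 /\
  lead_coef (skew_mulX delta v) = sigma (lead_coef v).
Proof.
move=> lv; have mv_size := size_map_poly_id0 lv.
have mv_neq0 : map_poly sigma v != 0.
  by rewrite -lead_coef_eq0 lead_coef_map_id0 ?rmorph0.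
have lt_size : (size (map_poly delta v) < size (map_poly sigma v * 'X)%R)%N.
  by rewrite size_mulX // mv_size ltnS size_poly.
rewrite /skew_mulX size_polyDl // lead_coefDl // lead_coefMX size_mulX //.
by rewrite mv_size lead_coef_map_id0 ?rmorph0.
Qed.

Lemma iter_skew_mulX_lead i v : (forall j, iter j sigma (lead_coef v) != 0) ->
  size (iter i (skew_mulX delta) v) = (i + size v)%N /\
  lead_coef (iter i (skew_mulX delta) v) = iter i sigma (lead_coef v).
Proof.
move=> lv; elim: i => //= i [IHs IHl].
have := @skew_mulX_lead (iter i (skew_mulX delta) v).
by rewrite IHs IHl => /(_ (lv i.+1)).
Qed.

(** Only the top term of [p] reaches the top degree, and [t^k] passes a coefficient as [sigma^k].
    Asking for nonvanishing of these particular elements lets the lemma serve monic factors over any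
    ring, before [sigma] is known to be injective. *)
Lemma skew_mul_lead p q (c := lead_coef (skew_val p))
    (e := iter (size (skew_val p)).-1 sigma (lead_coef (skew_val q))) :
    (forall j, iter j sigma (lead_coef (skew_val q)) != 0) -> c * e != 0 ->
  size (skew_val (p * q)) = (size (skew_val p) + size (skew_val q)).-1 /\
  lead_coef (skew_val (p * q)) = c * e.
Proof.
rewrite {}/e {}/c; case: p q => [u] [v] /= lv luv.
have v_gt0 : (0 < size v)%N by rewrite size_poly_gt0 -lead_coef_eq0 (lv 0%N).
case size_u: (size u) => [|k].
  by move: luv; rewrite lead_coefE size_u nth_default ?size_u // mul0r eqxx.
have le_u : (size u <= k.+1)%N by rewrite size_u.
rewrite (skew_act_widen delta v le_u) big_ord_recr /= addrC.
move: luv; rewrite size_u lead_coefE size_u /= => luv.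
set w := iter k (skew_mulX delta) v.
have [w_size w_lead] : size w = (k + size v)%N /\
  lead_coef w = iter k sigma (lead_coef v) by apply: iter_skew_mulX_lead.
have c_neq0 : u`_k != 0 by apply: contraNneq luv => ->; rewrite mul0r.
have cw : lead_coef (u`_k)%:P * lead_coef w != 0 by rewrite lead_coefC w_lead.
have top_size : size (u`_k *: w) = (k + size v)%N.
  by rewrite -mul_polyC size_proper_mul // size_polyC c_neq0 w_size.
have top_lead : lead_coef (u`_k *: w) = u`_k * iter k sigma (lead_coef v).
  by rewrite -mul_polyC lead_coef_proper_mul // lead_coefC w_lead.
have lt_size : (size (\sum_(i < k) u`_i *: iter i (skew_mulX delta) v)%R
    < size (u`_k *: w)%R)%N.
  rewrite top_size; apply: leq_ltn_trans (size_sum _ _ _) _.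
  case: (k) v_gt0 => [|k'] v_gt0; first by rewrite big_ord0.
  rewrite addSn ltnS; apply/bigmax_leqP => i _.
  rewrite (leq_trans (size_scale_leq _ _)) //.
  by rewrite (iter_skew_mulX_lead i lv).1 leq_add2r -ltnS.
by rewrite size_polyDl // lead_coefDl // top_size top_lead.
Qed.

Lemma skew_mul_monic p q : skew_monic p -> skew_monic q ->
  skew_monic (p * q) /\
  size (skew_val (p * q)) = (size (skew_val p) + size (skew_val q)).-1.
Proof.
rewrite /skew_monic => /monicP p1 /monicP q1.
have iter1 j : iter j sigma 1 = 1.
  by elim: j => //= j ->; rewrite rmorph1.
have [||->] := @skew_mul_lead p q; rewrite ?q1 ?p1 ?iter1 ?mulr1 ?oner_neq0 //.
- by move=> j; rewrite iter1 oner_neq0.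
- by move=> pq; split=> //; apply/monicP.
Qed.

Lemma size_skew_mulC p a : GRing.integral_domain_axiom A ->
  injective sigma -> a != 0 -> size (skew_val (p * skewC delta a)) = size (skew_val p).
Proof.
move=> domA inj_sigma a_neq0; have [p0|p_neq0] := eqVneq (skew_val p) 0.
  by rewrite /= p0 skew_act0l.
have iter_neq0 j : iter j sigma a != 0.
  by elim: j => //= j IH; rewrite -(rmorph0 sigma) (inj_eq inj_sigma).
have [||->] := @skew_mul_lead p (skewC delta a); rewrite /= ?lead_coefC //.
  by apply/negP=> /eqP/domA; rewrite lead_coef_eq0 (negPf p_neq0) (negPf (iter_neq0 _)).
by rewrite size_polyC a_neq0 addn1.
Qed.

(** Coefficients stand on the left, so left multiplication by a constant acts on each of them
    separately. This is why divisibility by powers of [x] is always stated with the power on the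
    left. *)
Lemma skew_dvdP (y : A) p :
  (forall i, exists b, (skew_val p)`_i = y * b) <-> exists q, p = skewC delta y * q.
Proof.
split=> [dvd_p|[q ->] i]; last by exists (skew_val q)`_i; rewrite skew_val_CM coefZ.
have /fin_all_exists[b bP] (i : 'I_(size (skew_val p))) := dvd_p i.
exists (SkewPoly (\sum_(i < size (skew_val p)) b i *: 'X^i)).
apply: val_inj; rewrite [RHS]skew_val_CM /= scaler_sumr -[LHS]coefK poly_def.
by apply: eq_bigr => i _; rewrite bP scalerA.
Qed.

(** * Reduction to [K[t]] *)

Variables (K : fieldType) (pi : {rmorphism A -> K}).
Hypothesis sigma_bar : forall a, pi (sigma a) = pi a.
Hypothesis delta_bar : forall a, pi (delta a) = 0.
Local Notation red := (skew_red pi).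

Lemma skew_redD p q : red (p + q) = red p + red q.
Proof. exact: rmorphD. Qed.

Lemma skew_redB p q : red (p - q) = red p - red q.
Proof. exact: rmorphB. Qed.

Lemma skew_redC a : red (skewC delta a) = (pi a)%:P.
Proof. exact: map_polyC. Qed.

(** Modulo the ideal [sigma] is the identity and [delta] is zero, so [t] commutes with the
    coefficients. Multiplicativity of the reduction rests on this. *)
Lemma map_skew_mulX i v :
  map_poly pi (iter i (skew_mulX delta) v) = map_poly pi v * 'X^i.
Proof.
elim: i => [|i IH] /=; first by rewrite mulr1.
rewrite exprSr mulrA -IH; move: (iter i _ v) => w; apply/polyP=> j.
rewrite coef_map coefD /= rmorphD /= !coefMX !coef_map /= delta_bar addr0.
by case: eqP; rewrite ?rmorph0 ?sigma_bar.
Qed.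

Lemma skew_redM p q : red (p * q) = red p * red q.
Proof.
case: p q => [u] [v]; rewrite /skew_red /= rmorph_sum /= mulrC.
rewrite -[in RHS](coefK u) poly_def rmorph_sum mulr_sumr /=.
by apply: eq_bigr => i _; rewrite !map_polyZ /= map_skew_mulX map_polyXn scalerAr.
Qed.

Lemma skew_red_lift (pi_surj : forall c, exists a, pi a = c) (c : {poly K}) :
  exists p, red p = c /\ (size (skew_val p) <= size c)%N.
Proof.
have /fin_all_exists[b bP] (i : 'I_(size c)) := pi_surj c`_i.
exists (SkewPoly (\sum_(i < size c) b i *: 'X^i)); split.
  rewrite /skew_red /= rmorph_sum /= -[RHS]coefK poly_def.
  by apply: eq_bigr => i _; rewrite map_polyZ /= map_polyXn bP.
apply: (leq_trans (size_sum _ _ _)); apply/bigmax_leqP => i _.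
by rewrite (leq_trans (size_scale_leq _ _)) // size_polyXn.
Qed.

End SkewDegree.

(** * Powers of the principal ideal *)

Section PrincipalIdeal.

Variables (A : nzRingType) (x : A) (mI : A -> Prop).
Hypothesis mI_right : forall a, mI a <-> right_multiples x a.
Hypothesis mI_left : forall a, mI a <-> left_multiples x a.

(** Since [xA = Ax], every factor [x] can be moved to the left past an arbitrary element, which
    collapses a sum of products to one multiple of [x ^+ n]. *)
Lemma ideal_powP n a : ideal_pow mI n a <-> exists b, a = x ^+ n * b.
Proof.
elim: n a => [|n IH] a; first by split=> // _; exists a; rewrite mul1r.
split=> [[s s_mI ->]|[b ->]]; last first.
  exists [:: (x, x ^+ n * b)]; last by rewrite big_seq1 /= exprS mulrA.
  move=> p; rewrite inE => /eqP -> /=; split; first by apply/mI_right; exists 1; rewrite mulr1.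
  by apply/IH; exists b.
have comm_x c : exists c', c * x = x * c'.
  by apply/(mI_right (c * x))/mI_left; exists c.
have comm_xn c : exists c', c * x ^+ n = x ^+ n * c'.
  elim: (n) c => [|k IHk] c; first by exists c; rewrite mul1r mulr1.
  have [c1 e1] := comm_x c; have [c2 e2] := IHk c1.
  by exists c2; rewrite exprS mulrA e1 -!mulrA e2.
rewrite big_seq; apply: (big_ind (fun a => exists b, a = x ^+ n.+1 * b)).
- by exists 0; rewrite mulr0.
- by move=> _ _ [b ->] [c ->]; exists (b + c); rewrite mulrDr.
move=> p /s_mI[/mI_right[b ->] /IH[c ->]]; have [b' e] := comm_xn b.
by exists (b' * c); rewrite exprS -!mulrA [b * _]mulrA e !mulrA.
Qed.

End PrincipalIdeal.

(** * Injectivity of [sigma], and the action of [phi] on degrees and residues *)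

Section Twist.

Variables (A : nzRingType) (x : A) (mI : A -> Prop).
Variables (K : fieldType) (pi : {rmorphism A -> K}).
Variables (sigma : {rmorphism A -> A}) (delta : sderivation sigma).
Variable phi : skew_poly delta -> skew_poly delta.
Hypothesis A_domain : GRing.integral_domain_axiom A.
Hypothesis x_neq0 : x != 0.
Hypothesis mI_right : forall a, mI a <-> right_multiples x a.
Hypothesis mI_left : forall a, mI a <-> left_multiples x a.
Hypothesis A_separated : adically_separated mI.
Hypothesis pi_ker : forall a, pi a = 0 <-> mI a.
Hypothesis delta_mI : forall a, mI a -> mI (delta a).
Hypothesis sigma_bar : forall a, pi (sigma a) = pi a.
Hypothesis delta_bar : forall a, pi (delta a) = 0.
Hypothesis phiP : forall p, phi p * skewC delta x = skewC delta x * p.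

Local Notation skewR := (skew_poly delta).
Local Notation X := (skewC delta x).
Local Notation red := (skew_red pi).
Implicit Types p q : skewR.

(* If sigma x were 0, then p * x would be constant for every p, whereas
   phi(t) * x = x * t has degree 1. *)
Lemma sigma_x_neq0 : sigma x != 0.
Proof.
apply/eqP=> sx0.
have const_mul p : exists b, skew_val (p * X) = b%:P.
  case: p => u /=; rewrite /skew_act.
  (* Each [t^i x] is a constant lying in the ideal. Such a constant is some [c * x], killed by
     [sigma] because [sigma x = 0], so only its [delta] part survives. *)
  have const_iter i : exists2 b, mI b & iter i (skew_mulX delta) x%:P = b%:P.
    elim: i => [|i [b b_mI /= ->]] /=.
      by exists x => //; apply/mI_left; exists 1; rewrite mul1r.
    exists (delta b); first exact: delta_mI.
    rewrite /skew_mulX !map_polyC /=; have /mI_left[c ->] := b_mI.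
    by rewrite rmorphM /= sx0 mulr0 mul0r add0r.
  elim/big_ind: _ => [|_ _ [b ->] [c ->]|i _]; first by exists 0.
    by exists (b + c); rewrite polyCD.
  have [b _ ->] := const_iter i.
  by exists (u`_i * b); rewrite -mul_polyC -polyCM.
have [b] := const_mul (phi (skewX delta)).
rewrite phiP skew_val_CM /= => /(congr1 (coefp 1)) /eqP.
by rewrite /= coefZ coefX mulr1 coefC (negPf x_neq0).
Qed.

(** If [sigma a = 0] and [a = x ^+ n * b], cancelling the powers of [sigma x] gives [sigma b = 0].
    Then [b] has residue zero, as [sigma] preserves residues, so one more [x] divides [a].
    Separatedness gives [a = 0]. *)
Lemma sigma_inj : injective sigma.
Proof.
apply: raddf_inj => a sa0; apply: A_separated => n.
elim: n => // n /(ideal_powP mI_right mI_left)[b eq_a].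
have /mI_right[c eq_b] : mI b.
  apply/pi_ker; rewrite -sigma_bar; move: (sa0 : sigma a = 0).
  rewrite eq_a rmorphM rmorphXn /=.
  elim: (n) => [|k IHk]; first by rewrite mul1r => ->; rewrite rmorph0.
  rewrite exprS -mulrA => /A_domain; rewrite (negPf sigma_x_neq0) => /eqP.
  exact: IHk.
by apply/(ideal_powP mI_right mI_left); exists c; rewrite eq_a eq_b exprSr mulrA.
Qed.

Lemma size_skew_mulXn n p : size (skew_val (p * X ^+ n)) = size (skew_val p).
Proof.
elim: n => [|n IH]; first by rewrite mulr1.
by rewrite exprSr mulrA (size_skew_mulC _ A_domain sigma_inj).
Qed.

Lemma skew_mulX_inj p q : p * X = q * X -> p = q.
Proof.
move/eqP; rewrite -subr_eq0 -mulrBl => /eqP pq0; apply/eqP; rewrite -subr_eq0.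
apply/eqP/val_inj/eqP; rewrite /= -size_poly_eq0.
have := size_skew_mulXn 1 (p - q).
by rewrite expr1 pq0 size_poly0 => <-.
Qed.

(** Degrees are compared in [phi p * x = x * p]: multiplication by [x] on either side preserves
    them. *)
Lemma size_phi p : size (skew_val (phi p)) = size (skew_val p).
Proof.
apply/eqP; rewrite -(size_skew_mulXn 1) expr1 phiP skew_val_CM.
have lreg_x : GRing.lreg x.
  move=> a b /eqP; rewrite -subr_eq0 -mulrBr => /eqP/A_domain.
  by rewrite (negPf x_neq0) subr_eq0 => /eqP.
by rewrite lreg_size.
Qed.

Lemma size_iter_phi n p : size (skew_val (iter n phi p)) = size (skew_val p).
Proof. by elim: n => //= n <-; rewrite size_phi. Qed.

Lemma skew_red_eq0P p : red p = 0 <-> exists q, p = X * q.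
Proof.
rewrite -skew_dvdP; split=> [p0 i|p_dvd].
  by apply/mI_right/pi_ker; rewrite -coef_map -/(red p) p0 coef0.
apply/polyP=> i; rewrite coef_map coef0; apply/pi_ker/mI_right; exact: p_dvd.
Qed.

Lemma skew_mulXn_comm n p : X ^+ n * p = iter n phi p * X ^+ n.
Proof.
elim: n => [|n IH]; first by rewrite mulr1 mul1r.
by rewrite exprS -mulrA IH mulrA -phiP -mulrA.
Qed.

(** [p * x] reduces to zero, hence lies in [xR]; the general case iterates this inclusion. *)
Lemma skew_Xn_dvdr n p : exists q, p * X ^+ n = X ^+ n * q.
Proof.
elim: n p => [|n IH] p; first by exists p; rewrite mulr1 mul1r.
have /skew_red_eq0P[q e] : red (p * X) = 0.
  rewrite skew_redM // skew_redC; have -> : pi x = 0.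
    by apply/pi_ker/mI_right; exists 1; rewrite mulr1.
  by rewrite mulr0.
by have [r er] := IH q; exists r; rewrite exprS mulrA e -!mulrA er.
Qed.

(** [phi] is given only through its defining relation, so the two sides are compared after right
    multiplication by [x], which can be cancelled. *)
Lemma red_phi p q : red p = red q -> red (phi p) = red (phi q).
Proof.
move=> /eqP; rewrite -subr_eq0 -skew_redB => /eqP/skew_red_eq0P[s eq_pq].
apply/eqP; rewrite -subr_eq0 -skew_redB; apply/eqP/skew_red_eq0P.
exists (phi s); apply: skew_mulX_inj.
by rewrite mulrBl -mulrA !phiP -mulrBr eq_pq.
Qed.

Lemma red_iter_phi n p q :
  red p = red q -> red (iter n phi p) = red (iter n phi q).
Proof. by move=> pq; elim: n => //= n; apply: red_phi. Qed.

(** * Adic limits of monic polynomials and Hensel lifting *)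

Hypothesis A_complete : adically_complete mI.
Hypothesis pi_surj : forall c, exists a, pi a = c.

(** The limit is taken separately for each of the [m] lower coefficients, while the leading
    coefficient stays equal to 1. *)
Lemma skew_monic_lim (u : nat -> skewR) m :
    (forall n, skew_monic (u n) /\ skew_has_degree (u n) m) ->
    (forall n, exists q, u n.+1 - u n = X ^+ n * q) ->
  exists l, [/\ skew_monic l, skew_has_degree l m
    & forall n, exists q, l - u n = X ^+ n * q].
Proof.
move=> u_monic u_cauchy.
have XnE n : X ^+ n = skewC delta (x ^+ n) by rewrite rmorphXn.
have /fin_all_exists[l lP] (j : 'I_m) : exists l, forall n,
    ideal_pow mI n (l - (skew_val (u n))`_j).
  apply: A_complete => n; apply/(ideal_powP mI_right mI_left).
  have [q e] := u_cauchy n; exists (skew_val q)`_j.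
  rewrite -coefB -coefZ -(skew_val_CM (x ^+ n)) -XnE -e.
  by rewrite [in RHS]raddfB.
(* [l] is indexed by ['I_m]; the default 0 is never reached for [j < m]. *)
pose L : {poly A} := 'X^m + \poly_(j < m) oapp l 0 (insub j).
have lt_size : (size (\poly_(j < m) oapp l 0 (insub j))%R < size ('X^m : {poly A}))%N.
  by rewrite size_polyXn ltnS size_poly.
exists (SkewPoly L); split.
- by rewrite /skew_monic /= /L; apply/monicP; rewrite lead_coefDl // lead_coefXn.
- by rewrite /skew_has_degree /= /L size_polyDl // size_polyXn.
move=> n; rewrite XnE; apply/skew_dvdP => j.
have [/monicP un1 un_size] := u_monic n.
have -> : (skew_val (SkewPoly L - u n))`_j = L`_j - (skew_val (u n))`_j.
  by rewrite raddfB coefB.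
rewrite /L coefD coefXn coef_poly; case: ltngtP => [lt_jm|lt_mj|->].
- by rewrite add0r insubT /=; apply/(ideal_powP mI_right mI_left)/(lP (Sub j lt_jm)).
- exists 0; rewrite mulr0 !addr0 nth_default ?subr0 //.
  by rewrite un_size.
- by exists 0; move: un1; rewrite lead_coefE un_size /= => ->; rewrite addr0 subrr mulr0.
Qed.

Lemma hensel_step n m k f g h r : (0 < n)%N ->
    skew_monic f -> skew_has_degree f (m + k) ->
    skew_monic g -> skew_has_degree g m -> skew_monic h -> skew_has_degree h k ->
    f = g * h + r * X ^+ n ->
    coprimep (red g) (red (iter n phi h)) ->
  exists a b r', [/\
    skew_monic (g + a * X ^+ n) /\ skew_has_degree (g + a * X ^+ n) m,
    skew_monic (h + b * X ^+ n) /\ skew_has_degree (h + b * X ^+ n) k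
    & f = (g + a * X ^+ n) * (h + b * X ^+ n) + r' * X ^+ n.+1].
Proof.
move=> n_gt0 f1 f_size g1 g_size h1 h_size eq_f gh_coprime.
have [gh1 gh_size] := skew_mul_monic g1 h1.
(* Here [n > 0] matters: it makes the quadratic term [a * phi^n(b) * x^n] vanish modulo [x]. *)
have red_Xn : red (X ^+ n) = 0.
  by apply/skew_red_eq0P; exists (X ^+ n.-1); rewrite -exprS prednK.
(* The leading terms of [f] and [g * h] cancel, and right multiplication by [x^n] preserves the
   degree of [r]. *)
have r_size : (size (skew_val r) <= m + k)%N.
  rewrite -(size_skew_mulXn n); have -> : r * X ^+ n = f - g * h.
    by rewrite eq_f addrC addKr.
  have -> : skew_val (f - g * h) = skew_val f - skew_val (g * h) by rewrite raddfB.
  apply/leq_sizeP => j; rewrite leq_eqVlt => /predU1P[<-|lt_j].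
    move: f1 gh1; rewrite /skew_monic !monicE !lead_coefE f_size gh_size g_size h_size.
    by rewrite addSn addnS /= coefB => /eqP -> /eqP ->; rewrite subrr.
  rewrite coefB !nth_default ?subr0 // ?f_size //.
  by rewrite gh_size g_size h_size addSn addnS.
have red_g1 : red g \is monic.
  by rewrite monicE lead_coef_map_id0 ?rmorph0 ?(monicP g1) ?rmorph1 ?oner_neq0.
have red_g_size : size (red g) = m.+1.
  by rewrite size_map_poly_id0 // (monicP g1) rmorph1 oner_neq0.
have [||a0 [b0 [eq_r a_size b_size]]] :=
    coprimep_solve (c := red r) (k := k) red_g1 gh_coprime.
- by rewrite red_g_size (leq_trans (size_poly _ _)).
- rewrite (leq_trans (size_poly _ _)) // size_iter_phi h_size //.
have [a [red_a size_a]] := skew_red_lift delta pi_surj a0.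
have [b [red_b size_b]] := skew_red_lift delta pi_surj b0.
have perturb p c j : skew_monic p -> skew_has_degree p j ->
    (size (skew_val c) <= j)%N ->
    skew_monic (p + c * X ^+ n) /\ skew_has_degree (p + c * X ^+ n) j.
  move=> p1 p_size c_size; rewrite /skew_monic /skew_has_degree.
  have -> : skew_val (p + c * X ^+ n) = skew_val p + skew_val (c * X ^+ n).
    by rewrite raddfD.
  have lt_size : (size (skew_val (c * X ^+ n)%R) < size (skew_val p))%N.
    by rewrite size_skew_mulXn p_size ltnS.
  by rewrite size_polyDl // monicE lead_coefDl.
(* The subtracted sum is what the corrected product adds to [g * h], with [x^n] factored out on the
   right. *)
have /skew_red_eq0P[s eq_s] : red (r - (g * b + a * iter n phi h
    + a * iter n phi b * X ^+ n)) = 0.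
  rewrite skew_redB !skew_redD !skew_redM // red_Xn mulr0 addr0 red_a red_b eq_r.
  by rewrite addrC [X in - X]addrC addNr.
(* The new error is [x * s * x^n], which equals [phi s * x^(n+1)]. *)
exists a, b, (phi s); split.
- apply: perturb => //; rewrite (leq_trans size_a) //.
  by move: a_size; rewrite red_g_size.
- by apply: perturb => //; rewrite (leq_trans size_b).
have -> : (g + a * X ^+ n) * (h + b * X ^+ n) = g * h
    + (g * b + a * iter n phi h + a * iter n phi b * X ^+ n) * X ^+ n.
  rewrite !mulrDl !mulrDr -!addrA; congr (_ + _).
  by rewrite -!mulrA skew_mulXn_comm ![X ^+ n * (_ * _)]mulrA skew_mulXn_comm !mulrA.
by rewrite exprS [phi s * _]mulrA phiP -eq_s -addrA -mulrDl subrKC.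
Qed.

Lemma hensel_lift m k (f g h : skewR) :
    skew_monic f -> skew_has_degree f (m + k) ->
    skew_monic g -> skew_has_degree g m -> skew_monic h -> skew_has_degree h k ->
    red f = red g * red h ->
    (forall n, (0 < n)%N -> coprimep (red g) (red (iter n phi h))) ->
  exists ghat hhat : skewR,
    [/\ skew_monic ghat /\ skew_has_degree ghat m,
        skew_monic hhat /\ skew_has_degree hhat k,
        red ghat = red g, red hhat = red h & f = ghat * hhat].
Proof.
move=> f1 f_size g1 g_size h1 h_size f_bar gh_coprime.
pose monic_of_degree j (p : skewR) := (skew_val p \is monic) && (size (skew_val p) == j.+1).
(* The witnesses r, a, b are part of the state to make the step conditions
   boolean, so that choice is available without any axiom. *)
pose approx n (s : skewR * skewR * skewR * skewR * skewR) :=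
  let: (p, q, r, _, _) := s in
  [&& monic_of_degree m p, monic_of_degree k q, red p == red g, red q == red h
    & f == p * q + r * X ^+ n.+1].
pose close n (s s' : skewR * skewR * skewR * skewR * skewR) :=
  let: (p, q, _, _, _) := s in let: (p', q', _, a, b) := s' in
  (p' == p + a * X ^+ n.+1) && (q' == q + b * X ^+ n.+1).
have [r0 eq_r0] : exists r, f - g * h = X * r.
  by apply/skew_red_eq0P; rewrite skew_redB skew_redM // f_bar subrr.
(* State [n] carries an error at [x^(n+1)], so the start needs [f - g * h = x * r0 = phi r0 * x].
   The two zeros are placeholders: [close] reads corrections only from the later state. *)
have [||u [u0 uP]] := @dependent_choice _ approx close (g, h, phi r0, 0, 0).
- rewrite /= /monic_of_degree !eqxx g_size h_size !eqxx [_ \is _]g1 [_ \is _]h1 /=.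
  by rewrite expr1 phiP -eq_r0 subrKC.
- move=> n [[[[p q] r] a'] b'] /and5P[/andP[p1 /eqP p_size] /andP[q1 /eqP q_size]].
  move=> /eqP red_p /eqP red_q /eqP eq_f.
  (* The approximations keep the residues of [g] and [h], and [phi] respects residues, so the
     original coprimality applies at every stage. *)
  have pq_coprime : coprimep (red p) (red (iter n.+1 phi q)).
    by rewrite red_p (red_iter_phi _ red_q) gh_coprime.
  have [a [b [r' [[pa1 pa_size] [qb1 qb_size] eq_f']]]] :=
    hensel_step (ltn0Sn n) f1 f_size p1 p_size q1 q_size eq_f pq_coprime.
  exists (p + a * X ^+ n.+1, q + b * X ^+ n.+1, r', a, b).
  have red_aX c : red (c * X ^+ n.+1) = 0.
    have [e ->] := skew_Xn_dvdr n.+1 c.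
    by apply/skew_red_eq0P; exists (X ^+ n * e); rewrite exprS mulrA.
  rewrite /= /monic_of_degree !skew_redD !red_aX !addr0 red_p red_q -eq_f' !eqxx.
  by rewrite [_ \is _]pa1 [_ \is _]qb1 pa_size qb_size !eqxx.
pose gs n := (u n).1.1.1.1; pose hs n := (u n).1.1.1.2; pose rs n := (u n).1.1.2.
have [||G [G1 G_size G_lim]] := @skew_monic_lim gs m.
- move=> n; have [] := uP n; rewrite /gs; case: (u n) => [[[[p q] r] a] b] /=.
  by case/and5P=> /andP[? /eqP ?].
- move=> n; have [_] := uP n; rewrite /gs.
  case: (u n) (u n.+1) => [[[[p q] r] a] b] [[[[p' q'] r'] a'] b'] /=.
  case/andP=> /eqP -> _; rewrite addrC addKr exprS mulrA; exact: skew_Xn_dvdr.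
have [||H [H1 H_size H_lim]] := @skew_monic_lim hs k.
- move=> n; have [] := uP n; rewrite /hs; case: (u n) => [[[[p q] r] a] b] /=.
  by case/and5P=> _ /andP[? /eqP ?].
- move=> n; have [_] := uP n; rewrite /hs.
  case: (u n) (u n.+1) => [[[[p q] r] a] b] [[[[p' q'] r'] a'] b'] /=.
  case/andP=> _ /eqP ->; rewrite addrC addKr exprS mulrA; exact: skew_Xn_dvdr.
have red_lim p q s : p - q = X ^+ 1 * s -> red p = red q.
  rewrite expr1 => pq; apply/eqP; rewrite -subr_eq0 -skew_redB; apply/eqP.
  by apply/skew_red_eq0P; exists s.
(* Index 1 is the first useful one: closeness at index 0 is only divisibility by [x^0 = 1]. *)
have red_u1 : red (gs 1) = red g /\ red (hs 1) = red h.
  have [] := uP 1; rewrite /gs /hs; case: (u 1) => [[[[p q] r] a] b] /=.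
  by case/and5P=> _ _ /eqP ? /eqP.
exists G, H; split=> //.
- by have [s /red_lim ->] := G_lim 1%N; case: red_u1.
- by have [s /red_lim ->] := H_lim 1%N; case: red_u1.
have dvd_diff n : exists q, f - G * H = X ^+ n * q.
  have [s eqG] := G_lim n; have [t eqH] := H_lim n.
  have eq_f : f = gs n * hs n + rs n * X * X ^+ n.
    have [] := uP n; rewrite /gs /hs /rs; case: (u n) => [[[[p q] r] a] b] /=.
    by case/and5P=> _ _ _ _ /eqP; rewrite exprS mulrA.
  have [r' eq_r'] := skew_Xn_dvdr n (rs n * X).
  have [t' eq_t'] := skew_Xn_dvdr n (gs n).
  (* This comes from [G * H - gs n * hs n = (G - gs n) * H + gs n * (H - hs n)], with each power of
     [x] moved to the left. *)
  exists (r' - s * H - t' * t).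
  rewrite !mulrBr mulrA -eqG mulrA -eq_t' -mulrA -eqH -eq_r' eq_f.
  by rewrite mulrBl mulrBr !opprB [RHS]addrAC !addrA subrK [_ * _ + _]addrC.
(* Every coefficient of [f - G * H] lies in all powers of the ideal, hence is zero by
   separatedness. *)
apply/eqP; rewrite -subr_eq0; apply/eqP/val_inj/polyP => j.
rewrite coef0; apply: A_separated => n; apply/(ideal_powP mI_right mI_left).
move: j; apply/skew_dvdP; have [q ->] := dvd_diff n; exists q.
by rewrite rmorphXn.
Qed.

End Twist.

Theorem proposition3p3
  (A : nzRingType) (A_domain : GRing.integral_domain_axiom A)
  (x : A) (x_neq0 : x != 0)
  (mI : A -> Prop)
  (mI_right : forall a, mI a <-> right_multiples x a)
  (mI_left : forall a, mI a <-> left_multiples x a)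
  (A_separated : adically_separated mI) (A_complete : adically_complete mI)
  (K : fieldType) (pi : {rmorphism A -> K})
  (pi_surj : forall c, exists a, pi a = c)
  (pi_ker : forall a, pi a = 0 <-> mI a)
  (sigma : {rmorphism A -> A}) (delta : sderivation sigma)
  (sigma_mI : forall a, mI a -> mI (sigma a))
  (delta_mI : forall a, mI a -> mI (delta a))
  (sigma_bar : forall a, pi (sigma a) = pi a)
  (delta_bar : forall a, pi (delta a) = 0)
  (phi : skew_poly delta -> skew_poly delta)
  (phiP : forall p, phi p * skewC delta x = skewC delta x * p)
  (d m : nat) (le_m_d : (m <= d)%N)
  (f : skew_poly delta) (f_monic : skew_monic f) (f_deg : skew_has_degree f d)
  (g h : skew_poly delta)
  (g_monic : skew_monic g) (g_deg : skew_has_degree g m)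
  (h_monic : skew_monic h) (h_deg : skew_has_degree h (d - m))
  (f_bar : skew_red pi f = skew_red pi g * skew_red pi h)
  (gh_coprime : forall n : nat, (0 < n)%N ->
     coprimep (skew_red pi g) (skew_red pi (iter n phi h))) :
  exists ghat hhat : skew_poly delta,
    [/\ skew_monic ghat /\ skew_has_degree ghat m,
        skew_monic hhat /\ skew_has_degree hhat (d - m),
        skew_red pi ghat = skew_red pi g,
        skew_red pi hhat = skew_red pi h
      & f = ghat * hhat].
Proof.
apply: (hensel_lift A_domain x_neq0 mI_right mI_left A_separated pi_ker delta_mI
  sigma_bar delta_bar phiP A_complete pi_surj) => //.
by rewrite subnKC.
Qed.
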